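(* Assume the belief system process $x_{k+1}=Px_k$ (defined in the context) converges to equilibrium. Let $S$ be a strongly connected component of the belief system graph $\mathcal{P}$, with factors $A_S$ and $C_S$, i.e. $P_S=A_S\otimes C_S$. If $S$ is closed, then $$\lim_{k\to\infty}x_k^i=(\pi_{A_S}\otimes\pi_{C_S})'\,(x_0^{A_S}\otimes x_0^{C_S})\qquad\text{for all } i\in S.$$ Moreover, if $S$ is open with edges coming from the set of nodes $S^M$, then $$\lim_{k\to\infty}x_k^i=\sum_{j\in S^M}p_{ij}\,x_\infty^j\qquad\text{for all } i\in S,$$ where $p_{ij}$ is the probability of absorption of a random walk starting at node $i$ into a node $j\in S^M$ with limiting value $x_\infty^j$.
   Context: Belief system with logic constraints. There are $n$ agents and $m$ truth statements. $A\in\mathbb{R}^{n\times n}$ and $C\in\mathbb{R}^{m\times m}$ are entrywise nonnegative row-stochastic matrices, and $\Lambda=\mathrm{diag}(\lambda^1,\dots,\lambda^n)$ with $0\le\lambda^i\le1$. The belief system is the recursion $x_{k+1}=Px_k$ on $[0,1]^{2nm}$, where $$P=\begin{pmatrix}(\Lambda A)\otimes C & (I_n-\Lambda)\otimes I_m\\ 0 & I_{nm}\end{pmatrix},$$ $I_r$ is the $r\times r$ identity, $0$ is the $nm\times nm$ zero matrix, and $\otimes$ is the Kronecker product. ($x_k$ stacks the current beliefs of all agents on all statements followed by all initial beliefs.) Here $x_k^i$ denotes the $i$-th coordinate of $x_k\in\mathbb{R}^{2nm}$. The process converges to equilibrium if for every initial value $x_0$ the limit $\lim_{k\to\infty}x_k=\lim_{k\to\infty}P^kx_0=x_\infty$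 exists. The belief system graph $\mathcal{P}$ is the directed graph on $\{1,\dots,2nm\}$ with an edge from $\ell$ to $r$ iff $P_{r\ell}>0$. A strongly connected component is closed if it has no incoming edges from nodes outside the component, and otherwise open. For a set of nodes $S$, $x_k^S$ is the vector of the coordinates of $x_k$ in $S$, and $P_S$ is the submatrix of $P$ with rows and columns in $S$. For closed $S$, $P_S$ is row-stochastic, and $\pi_{A_S}$, $\pi_{C_S}$ are the stationary distributions (left eigenvectors for eigenvalue $1$, normalized to be probability vectors) of the row-stochastic factors $A_S$ and $C_S$: $\pi_{A_S}'A_S=\pi_{A_S}'$, $\pi_{C_S}'C_S=\pi_{C_S}'$. The prime denotes transpose. The vectors $x_0^{A_S}$ and $x_0^{C_S}$, indexed by the nodes of the factors $A_S$ and $C_S$ respectively, are the factors of the vector of initial values of the nodes of $S$, i.e. $x_0^S=x_0^{A_S}\otimes x_0^{C_S}$, the coordinates of $x_0^S$ being ordered compatibly with $P_S=A_S\otimes C_S$. For open $S$, $S^M$ is the set of nodes outside $S$ having an edge into some node of $S$, and $x_{k+1}^S=Zx_k^S+Rx_k^{S^M}$, where $Z=P_S$ and $R$ is the submatrix of $P$ with rows in $S$ and columns in $S^M$. The random walk is the Markov chain with transition matrix $P$ (jumping from $i$ to $j$ with probability $P_{ij}$), with the nodes of $S^M$ regarded as absorbing; $p_{ij}$ is the probability that the walk started at $i\in S$ is absorbed at $j\in S^M$, i.e. that $j$ is the first node outside $S$ that it visits. *)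

(* Defs.v *)
From HB Require Import structures.
From mathcomp Require Import all_boot all_order all_algebra.
From mathcomp Require Import mxtens.
From mathcomp Require Import all_classical all_reals all_analysis.

Set Implicit Arguments.
Unset Strict Implicit.
Unset Printing Implicit Defensive.

Import Order.TTheory GRing.Theory Num.Theory.
Import numFieldNormedType.Exports.

Local Open Scope ring_scope.
Local Open Scope classical_set_scope.

Definition row_stochastic (R : realType) (n : nat) (A : 'M[R]_n) : Prop :=
  (forall i j, 0 <= A i j) /\ (forall i, \sum_j A i j = 1).

(* *t is the Kronecker product of mxtens. *)
Definition belief_matrix (R : realType) (n m : nat) (A : 'M[R]_n)
    (C : 'M[R]_m) (lam : 'rV[R]_n) : 'M[R]_(n * m + n * m) :=
  block_mx ((diag_mx lam *m A) *t C) ((1%:M - diag_mx lam) *t (1%:M : 'M[R]_m))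
           0                         1%:M.

Definition in_unit_cube (R : realType) (N : nat) (x : 'cV[R]_N) : Prop :=
  forall i, 0 <= x i 0 <= 1.

Definition process (R : realType) (N : nat) (P : 'M[R]_N) (x0 : 'cV[R]_N)
    (k : nat) : 'cV[R]_N :=
  iter k (mulmx P) x0.

Definition converges_to_equilibrium (R : realType) (N : nat) (P : 'M[R]_N) :
    Prop :=
  forall x0 : 'cV[R]_N, in_unit_cube x0 -> cvgn (process P x0).

Definition equilibrium (R : realType) (N : nat) (P : 'M[R]_N)
    (x0 : 'cV[R]_N) : 'cV[R]_N :=
  limn (process P x0).

(* Edges run against the index order of P: l -> r iff P r l > 0. *)
Definition system_graph (R : realType) (N : nat) (P : 'M[R]_N) : rel 'I_N :=
  fun l r => 0 < P r l.

(* Equivalence classes of mutual reachability; a single node lying on no cycle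
   is a component. *)
Definition strong_component (V : finType) (e : rel V) (S : {set V}) : Prop :=
  S \in equivalence_partition (fun u v => connect e u v && connect e v u)
                              [set: V]%SET.

Definition in_neighbours (V : finType) (e : rel V) (S : {set V}) : {set V} :=
  [set l | (l \notin S) && [exists r in S, e l r]]%SET.

Definition closed_component (V : finType) (e : rel V) (S : {set V}) : Prop :=
  strong_component e S /\ (forall l r, l \notin S -> r \in S -> ~~ e l r).

Definition open_component (V : finType) (e : rel V) (S : {set V}) : Prop :=
  strong_component e S /\ ~ (forall l r, l \notin S -> r \in S -> ~~ e l r).

(* e lists the nodes of S in the order in which P_S is AS *t CS; the factors
   need not be submatrices of A and C (on the components of the last n * m
   coordinates they are not). *)
Definition factors_of_submatrix (R : realType) (N : nat) (P : 'M[R]_N)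
    (S : {set 'I_N}) (a c : nat) (e : 'I_(a * c) -> 'I_N)
    (AS : 'M[R]_a) (CS : 'M[R]_c) : Prop :=
  [/\ injective e, S = [set e t | t : 'I_(a * c)]%SET
    & mxsub e e P = AS *t CS].

Definition stationary_distribution (R : realType) (n : nat) (A : 'M[R]_n)
    (p : 'cV[R]_n) : Prop :=
  [/\ forall i, 0 <= p i 0, \sum_i p i 0 = 1 & p^T *m A = p^T].

Definition absorbing_at (R : realType) (N : nat) (T : {set 'I_N})
    (P : 'M[R]_N) : 'M[R]_N :=
  \matrix_(i, j) (if i \in T then (i == j)%:R else P i j).

(* X is a Markov chain with transition matrix Q started at i0. The last clause
   is Pr(X_{k+1} = s_{k+1} | X_0 = s_0, ..., X_k = s_k) = Q s_k s_{k+1},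
   multiplied out so that null conditioning events are allowed. *)
Definition markov_chain_from (R : realType) (N : nat) (Q : 'M[R]_N)
    (i0 : 'I_N) (d : measure_display) (Omega : measurableType d)
    (Pr : probability Omega R) (X : nat -> Omega -> 'I_N) : Prop :=
  [/\ forall k v, measurable [set w | X k w = v],
      Pr [set w | X 0%N w = i0] = 1%E
    & forall (k : nat) (s : nat -> 'I_N),
        Pr [set w | forall l, (l <= k.+1)%N -> X l w = s l] =
        (Pr [set w | forall l, (l <= k)%N -> X l w = s l]
           * (Q (s k) (s k.+1))%:E)%E].

(* j is the first node outside S that X visits *)
Definition absorption_event (N : nat) (Omega : Type) (X : nat -> Omega -> 'I_N)
    (S : {set 'I_N}) (j : 'I_N) : set Omega :=
  [set w | exists k, X k w = j /\ forall l, (l < k)%N -> X l w \in S].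

Definition absorption_probability (R : realType) (N : nat)
    (d : measure_display) (Omega : measurableType d)
    (Pr : probability Omega R) (X : nat -> Omega -> 'I_N)
    (S : {set 'I_N}) (j : 'I_N) : R :=
  fine (Pr (absorption_event X S j)).

(* Main.v *)
Require Import Defs.
From HB Require Import structures.
From mathcomp Require Import all_boot all_order all_algebra.
From mathcomp Require Import mxtens.
From mathcomp Require Import all_classical all_reals all_analysis.

Set Implicit Arguments.
Unset Strict Implicit.
Unset Printing Implicit Defensive.

Import Order.TTheory GRing.Theory Num.Theory.
Import numFieldNormedType.Exports.

Local Open Scope ring_scope.
Local Open Scope classical_set_scope.

(** The limit vector is harmonic, i.e. it satisfies [y = P y], and a maximum
principle determines its values on [S].

The matrix [P] is row-stochastic, so the value of a harmonic [y] at a node [v]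
is an average of its values at the nodes [w] with [P v w > 0]. If [y] attains on
the strongly connected set [S] its maximum over [S] and its in-neighbours, it
takes that maximum at all of these nodes ([harmonic_max_spreads]).

When [S] is closed there are no in-neighbours, so the limit is constant on [S]
([equilibrium_constant]). The stationary vector [piA *t piC] of
[P_S = AS *t CS] has an inner product with the restriction of [x_k] to [S] that
does not depend on [k]; comparing its values at [k = 0] and in the limit
identifies the constant ([closed_component_limit]).

When [S] is open, follow the walk from [i] until it leaves [S]. With [g k v] the
probability that the walk is at [v] at time [k] and was in [S] at all earlier
times, the Markov property gives [g (k+1) v = \sum_(u in S) g k u * P u v], and
the harmonicity of [y] on [S] then gives, for every [k],
[y i = \sum_(j in SM) (\sum_(l <= k) g l j) * y j + \sum_(v in S) g k v * y v]
([harmonic_stopped]). The inner sums increase to the absorption probabilities.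
The last sum vanishes in the limit since the walk leaves [S] almost surely:
the limit of the survival probabilities, extended by 0 outside [S], is harmonic
on [S], so if it were positive somewhere, the maximum principle would make it
positive at an in-neighbour of [S], where it is 0 ([survival_cvg0]). *)

(** * The belief matrix is row-stochastic *)

Lemma const1_tens (R : pzRingType) (m n p q : nat) :
  const_mx 1 = const_mx 1 *t const_mx 1 :> 'M[R]_(m * p, n * q).
Proof.
apply/matrixP => i j.
case: (mxtens_indexP i) => i1 i2; case: (mxtens_indexP j) => j1 j2.
by rewrite tensmxE !mxE mulr1.
Qed.

Lemma tensmxDl (R : pzRingType) (m n p q : nat) (A B : 'M[R]_(m, n))
    (D : 'M[R]_(p, q)) : (A + B) *t D = A *t D + B *t D.
Proof.
apply/matrixP => i j.
case: (mxtens_indexP i) => i1 i2; case: (mxtens_indexP j) => j1 j2.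
by rewrite [RHS]mxE !tensmxE mxE mulrDl.
Qed.

(** Stated with one column, whereas [tensmx_mul] rewrites only a column number
of the form [1 * 1]. *)
Lemma tensmx_mul_ones (R : comPzRingType) (m n p q : nat) (B : 'M[R]_(m, n))
    (D : 'M[R]_(p, q)) :
  (B *t D) *m (const_mx 1 : 'cV[R]_(n * q)) =
  (B *m (const_mx 1 : 'cV_n)) *t (D *m (const_mx 1 : 'cV_q)) :> 'cV_(m * p).
Proof.
have := tensmx_mul B D (const_mx 1 : 'cV_n) (const_mx 1 : 'cV_q).
by rewrite -const1_tens.
Qed.

(** Row sums are products with the all-ones vector, which is itself a tensor
product of all-ones vectors. In the top row the two blocks thus contribute
[lam] and [1 - lam] to the row sums. *)
Lemma belief_matrix_stochastic (R : realType) (n m : nat) (A : 'M[R]_n)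
    (C : 'M[R]_m) (lam : 'rV[R]_n) :
  row_stochastic A -> row_stochastic C -> (forall i, 0 <= lam 0 i <= 1) ->
  row_stochastic (belief_matrix A C lam).
Proof.
move=> [A0 A1] [C0 C1] hlam; split.
  move=> i j; rewrite /belief_matrix mxE.
  case: split_ordP => i' _; rewrite mxE; case: split_ordP => j' _.
  - case: (mxtens_indexP i') => i1 i2; case: (mxtens_indexP j') => j1 j2.
    rewrite tensmxE mul_diag_mx mxE mulr_ge0 ?mulr_ge0//.
    by have /andP[] := hlam i1.
  - case: (mxtens_indexP i') => i1 i2; case: (mxtens_indexP j') => j1 j2.
    rewrite tensmxE !mxE mulr_ge0 ?ler0n//.
    case: eqVneq => [->|_]; last by rewrite !mulr0n subr0.
    by rewrite !mulr1n subr_ge0; have /andP[] := hlam j1.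
  - by rewrite mxE.
  - by rewrite mxE ler0n.
pose one k : 'cV[R]_k := const_mx 1.
have oneE k (B : 'M[R]_k) : (forall i, \sum_j B i j = 1) -> B *m one k = one k.
  move=> B1; apply/colP => i; rewrite !mxE -[RHS](B1 i).
  by apply: eq_bigr => j _; rewrite mxE mulr1.
suff P1 : belief_matrix A C lam *m one _ = one _.
  move=> i; have /colP/(_ i) := P1; rewrite mxE [RHS]mxE => <-.
  by apply: eq_bigr => j _; rewrite [one _ _ _]mxE mulr1.
have -> : one (n * m + n * m)%N = col_mx (one _) (one _).
  by rewrite col_mx_const.
rewrite mul_block_col mul0mx add0r mul1mx; congr col_mx.
rewrite !tensmx_mul_ones mul1mx -mulmxA (oneE _ _ A1) (oneE _ _ C1).
have lam1 : diag_mx lam *m one n + (1%:M - diag_mx lam) *m one n = one n.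
  by rewrite -mulmxDl addrC subrK mul1mx.
have := tensmxDl (diag_mx lam *m one n) ((1%:M - diag_mx lam) *m one n) (one m).
by rewrite lam1 -const1_tens => E; exact: esym E.
Qed.

(** * A maximum principle on strongly connected components *)

(** A mean of values at most [M] equals [M] only if each value of positive weight
does. Edges run from [w] to [v] when [P v w > 0], so this carries the maximum
backwards along the paths leading to [v0], hence through all of [S], and one
edge further to the in-neighbours. *)
Lemma harmonic_max_spreads (R : realType) (N : nat) (P : 'M[R]_N)
    (S : {set 'I_N}) (y : 'I_N -> R) (M : R) (v0 : 'I_N) :
  let e := system_graph P in
  row_stochastic P -> strong_component e S ->
  {in S, forall v, y v = \sum_w P v w * y w} ->
  {in S :|: in_neighbours e S, forall w, y w <= M} ->
  v0 \in S -> y v0 = M ->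
  {in S :|: in_neighbours e S, forall w, y w = M}.
Proof.
move=> e [P0 P1] Scomp yharm yM v0S yv0.
have in_nbr v w : v \in S -> 0 < P v w -> w \in (S :|: in_neighbours e S)%SET.
  move=> vS Pvw; rewrite !inE; case: (boolP (w \in S)) => //= _.
  by apply/existsP; exists v; rewrite vS.
have local v w : v \in S -> y v = M -> 0 < P v w -> y w = M.
  move=> vS yv Pvw.
  have gap0 : \sum_u P v u * (M - y u) = 0.
    under eq_bigr do rewrite mulrBr.
    by rewrite sumrB -mulr_suml P1 mul1r -yharm// yv subrr.
  have /(_ w isT)/eqP : forall u, true -> P v u * (M - y u) = 0.
    apply: psumr_eq0P gap0 => u _.
    case: (ltrgt0P (P v u)) (P0 v u) => // [Pvu _|-> _]; last by rewrite mul0r.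
    by rewrite mulr_ge0 ?(ltW Pvu)// subr_ge0 yM// (in_nbr v).
  by rewrite mulf_eq0 gt_eqF//= subr_eq0 => /eqP.
have S_conn u v : u \in S -> v \in S -> connect e u v.
  move: Scomp => /imsetP[x _ ->]; rewrite !inE /= => /andP[_ ux] /andP[xv _].
  exact: connect_trans ux xv.
have S_conv u v : v \in S -> connect e u v -> connect e v u -> u \in S.
  move: Scomp => /imsetP[x _ ->]; rewrite !inE /= => /andP[xv vx] uv vu.
  by rewrite (connect_trans xv vu) (connect_trans uv vx).
(* Backward induction along a path from [v] to [v0]; its nodes stay in [S],
   because they lie on a closed walk through [v]. *)
have in_S v : v \in S -> y v = M.
  move=> vS; have /connectP[p] := S_conn _ _ vS v0S.
  elim: p v vS => [|w p IHp] v vS /=; first by move=> _ <-.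
  move=> /andP[evw ep] lastp.
  have wS : w \in S.
    apply: (S_conv _ _ vS _ (connect1 evw)); apply: (@connect_trans _ _ v0).
      by apply/connectP; exists p.
    exact: S_conn.
  exact: local wS (IHp w wS ep lastp) evw.
move=> w /setUP[|]; first exact: in_S.
rewrite inE => /andP[_ /existsP[v /andP[vS ewv]]].
exact: local vS (in_S v vS) ewv.
Qed.

(** * The limit of the process *)

Lemma cvg_sumr (R : realType) (I : Type) (r : seq I) (p : pred I)
    (u : I -> nat -> R) (l : I -> R) :
  (forall i, p i -> u i k @[k --> \oo] --> l i) ->
  \sum_(i <- r | p i) u i k @[k --> \oo] --> \sum_(i <- r | p i) l i.
Proof. exact: (@cvg_big R I _ 0 p (@add_continuous R)). Qed.

Lemma process_cvg_coord (R : realType) (N : nat) (P : 'M[R]_N) (x0 : 'cV[R]_N)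
    (i : 'I_N) :
  cvgn (process P x0) ->
  process P x0 k i 0 @[k --> \oo] --> equilibrium P x0 i 0.
Proof.
move=> cvx; apply: (cvg_comp (process P x0) (fun M => M i 0) cvx).
exact: coord_continuous.
Qed.

Lemma equilibrium_fixed (R : realType) (N : nat) (P : 'M[R]_N)
    (x0 : 'cV[R]_N) (v : 'I_N) :
  cvgn (process P x0) ->
  equilibrium P x0 v 0 = \sum_w P v w * equilibrium P x0 w 0.
Proof.
move=> cvx; apply: (@cvg_unique _ (@Rhausdorff R)
  (process P x0 k.+1 v 0 @[k --> \oo])).
  have := @process_cvg_coord R N P x0 v cvx.
  by rewrite -cvg_shiftS.
rewrite /process /=; under eq_fun do rewrite mxE.
apply: cvg_sumr => w _; apply: cvgMl_tmp; exact: process_cvg_coord.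
Qed.

Lemma equilibrium_constant (R : realType) (N : nat) (P : 'M[R]_N)
    (S : {set 'I_N}) (x0 : 'cV[R]_N) :
  row_stochastic P -> closed_component (system_graph P) S ->
  cvgn (process P x0) ->
  {in S &, forall u v, equilibrium P x0 u 0 = equilibrium P x0 v 0}.
Proof.
move=> hP [Scomp Sclosed] cvx u v uS vS.
case: (arg_maxP (fun w => equilibrium P x0 w 0) uS) => w wS wmax.
have no_nbr : (S :|: in_neighbours (system_graph P) S)%SET = S.
  apply/finset.setUidPl/fintype.subsetP => l.
  rewrite inE => /andP[lS /existsP[r /andP[rS]]].
  by rewrite (negbTE (Sclosed l r lS rS)).
have := @harmonic_max_spreads R N P S (fun w => equilibrium P x0 w 0) _ w hP
  Scomp (fun v _ => equilibrium_fixed v cvx).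
by rewrite no_nbr => /(_ _ wmax wS erefl) eqw; rewrite !eqw.
Qed.

(** * Closed components *)

Lemma stationary_tens (R : realType) (a c : nat) (AS : 'M[R]_a) (CS : 'M[R]_c)
    (piA : 'cV[R]_a) (piC : 'cV[R]_c) :
  stationary_distribution AS piA -> stationary_distribution CS piC ->
  let pi : 'rV[R]_(a * c) := (piA *t piC)^T in
  pi *m (AS *t CS) = pi /\ \sum_t pi 0 t = 1.
Proof.
move=> [_ sA fA] [_ sC fC] pi; split.
  by have := tensmx_mul piA^T piC^T AS CS; rewrite fA fC -trmx_tens.
have -> : \sum_t pi 0 t = (pi *m (const_mx 1 : 'cV_(a * c))) 0 0.
  by rewrite mxE; apply: eq_bigr => t _; rewrite [const_mx _ _ _]mxE mulr1.
have one1 k (p : 'cV[R]_k) : \sum_i p i 0 = 1 ->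
    p^T *m const_mx 1 = 1 :> 'M[R]_1.
  move=> p1; apply/matrixP => i j; rewrite !ord1 !mxE -[RHS]p1.
  by apply: eq_bigr => l _; rewrite !mxE mulr1.
have := tensmx_mul_ones piA^T piC^T.
rewrite (one1 _ piA)// (one1 _ piC)// -trmx_tens => ->.
by rewrite !mxE !ord1 mulr1.
Qed.

(** * The walk leaves an open component *)

(** The probability that the walk started at [v] is in [S] at all times up to
[k], by first-step analysis. *)
Fixpoint survival (R : realType) (N : nat) (P : 'M[R]_N) (S : {set 'I_N})
    (k : nat) (v : 'I_N) : R :=
  if v \in S then
    (if k is k'.+1 then \sum_w P v w * survival P S k' w else 1)
  else 0.

Lemma survivalS (R : realType) (N : nat) (P : 'M[R]_N) (S : {set 'I_N})
    (k : nat) (v : 'I_N) :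
  survival P S k.+1 v =
  if v \in S then \sum_w P v w * survival P S k w else 0.
Proof. by []. Qed.

Lemma survival_ge0 (R : realType) (N : nat) (P : 'M[R]_N) (S : {set 'I_N})
    (k : nat) (v : 'I_N) : row_stochastic P -> 0 <= survival P S k v.
Proof.
move=> [P0 _]; elim: k v => [|k IHk] v /=; case: ifP => // _.
by apply: sumr_ge0 => w _; rewrite mulr_ge0.
Qed.

Lemma survival_nonincreasing (R : realType) (N : nat) (P : 'M[R]_N)
    (S : {set 'I_N}) (k : nat) (v : 'I_N) :
  row_stochastic P -> survival P S k.+1 v <= survival P S k v.
Proof.
move=> [P0 P1]; elim: k v => [|k IHk] v; last first.
  rewrite survivalS [leRHS]survivalS; case: ifP => // _.
  by apply: ler_sum => w _; rewrite ler_wpM2l.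
rewrite /=; case: ifP => // _; rewrite -[leRHS](P1 v).
by apply: ler_sum => w _; case: ifP => _; rewrite ?mulr1 ?mulr0.
Qed.

(** The decreasing limit [h] is harmonic on [S] and vanishes outside. Its maximum
over [S] bounds it everywhere, so by the maximum principle it is also the value
of [h] at an in-neighbour of [S], which exists as [S] is open; that value
is 0. *)
Lemma survival_cvg0 (R : realType) (N : nat) (P : 'M[R]_N) (S : {set 'I_N})
    (v : 'I_N) :
  row_stochastic P -> open_component (system_graph P) S ->
  survival P S k v @[k --> \oo] --> (0 : R).
Proof.
move=> hP [Scomp Sopen].
have [l lnbr] : exists l, l \in in_neighbours (system_graph P) S.
  apply: contrapT => noin; apply: Sopen => l r lS rS; apply/negP => elr.
  apply: noin; exists l; rewrite inE lS; apply/existsP; exists r.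
  by rewrite rS.
have lS : l \notin S by move: lnbr; rewrite inE => /andP[].
pose h w : R := limn (fun k => survival P S k w).
have hcvg w : survival P S k w @[k --> \oo] --> h w.
  apply: nonincreasing_is_cvgn.
    by apply/nonincreasing_seqP => k; exact: survival_nonincreasing.
  by exists 0 => _ [k _ <-]; exact: survival_ge0.
have h0 w : 0 <= h w.
  by apply: limr_ge; [exact: hcvg|near=> k; exact: survival_ge0].
have hout w : w \notin S -> h w = 0.
  move=> wS; apply: (@cvg_unique _ (@Rhausdorff R) _ _ _ _ (hcvg w)).
  have -> : survival P S ^~ w = fun=> 0.
    by apply/funext => -[|k] /=; rewrite (negbTE wS).
  exact: cvg_cst.
have hharm : {in S, forall w, h w = \sum_u P w u * h u}.
  move=> w wS; apply: (@cvg_unique _ (@Rhausdorff R)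
      (survival P S k.+1 w @[k --> \oo])).
    by have := hcvg w; rewrite -cvg_shiftS.
  rewrite /= wS; apply: cvg_sumr => u _; apply: cvgMl_tmp; exact: hcvg.
case: (boolP (v \in S)) => [vS|vS]; last by rewrite -(hout v vS).
case: (arg_maxP h vS) => w wS wmax.
have hmax : {in S :|: in_neighbours (system_graph P) S, forall u, h u <= h w}.
  move=> u _; case: (boolP (u \in S)) => [/wmax//|/hout->]; exact: h0.
have hw := harmonic_max_spreads hP Scomp hharm hmax wS erefl.
have hw0 : h w = 0 by rewrite -(hw l) ?hout// inE lnbr orbT.
by have := hcvg v; rewrite (hw v) ?hw0// inE vS.
Unshelve. all: by end_near.
Qed.

(** * The Markov property before the exit from a set *)

Lemma probability_split (R : realType) (N : nat) (d : measure_display)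
    (Omega : measurableType d) (Pr : probability Omega R)
    (Y : Omega -> 'I_N) (S : {set 'I_N}) (E : set Omega) :
  (forall v, measurable [set w | Y w = v]) -> measurable E ->
  (forall w, E w -> Y w \in S) ->
  Pr E = (\sum_(u in S) Pr (E `&` [set w | Y w = u]))%E.
Proof.
move=> mY mE ES.
have mF u : measurable (E `&` [set w | Y w = u]) by exact: measurableI.
have EU : \big[setU/set0]_(u < N) (E `&` [set w | Y w = u]) = E.
  rewrite -(bigcup_pred predT); apply/seteqP; split => [w [u _ []]//|w Ew].
  by exists (Y w).
rewrite -[in LHS]EU measure_semi_additive_ord//; last 2 first.
- by move=> u v _ _ [w [[_ /= <-] [_ /= <-]]].
- by rewrite EU.
rewrite [RHS]big_mkcond/=; apply: eq_bigr => u _; case: ifPn => // uS.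
rewrite (_ : _ `&` _ = set0) ?measure0//.
by apply/seteqP; split => // w [/ES YS /= Yu]; rewrite Yu (negbTE uS) in YS.
Qed.

(** The coordinates before [j] are only constrained to lie in [S], those from [j]
to [k] are prescribed. For [j = 0] these are the cylinders of the definition of
a Markov chain, for [j = k] the event that [s k] is reached at time [k] through
[S]; letting [j] grow connects the two. *)
Definition cylinder (N : nat) (Omega : Type) (X : nat -> Omega -> 'I_N)
    (S : {set 'I_N}) (s : nat -> 'I_N) (j k : nat) : set Omega :=
  [set w | forall l, (l <= k)%N -> if (l < j)%N then is_true (X l w \in S)
                                   else X l w = s l].

Lemma measurable_cylinder (N : nat) (d : measure_display)
    (Omega : measurableType d) (X : nat -> Omega -> 'I_N) (S : {set 'I_N})
    (s : nat -> 'I_N) (j k : nat) :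
  (forall k v, measurable [set w | X k w = v]) ->
  measurable (cylinder X S s j k).
Proof.
move=> mX.
have -> : cylinder X S s j k = \bigcap_(l in `I_k.+1)
    [set w | if (l < j)%N then is_true (X l w \in S) else X l w = s l].
  by apply/seteqP; split => w /= Xw l; exact: Xw.
apply: bigcap_measurableType => l _; case: (l < j)%N; last exact: mX.
have -> : [set w | X l w \in S] = \bigcup_(v in [set` S]) [set w | X l w = v].
  by apply/seteqP; split => [w XS|w [v vS /= ->]//]; exists (X l w).
by apply: fin_bigcup_measurable => // v _; exact: mX.
Qed.

(** The Markov property, conditionally on a past confined to [S]. Summing over the
value in [S] of coordinate [j] turns its prescription into mere membership; this
leaves the factor [Q (s k) (s k.+1)] alone as long as [j < k]. *)
Lemma cylinder_step (R : realType) (N : nat) (Q : 'M[R]_N) (i0 : 'I_N)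
    (d : measure_display) (Omega : measurableType d) (Pr : probability Omega R)
    (X : nat -> Omega -> 'I_N) (S : {set 'I_N}) (s : nat -> 'I_N) (j k : nat) :
  markov_chain_from Q i0 Pr X -> (j <= k)%N ->
  Pr (cylinder X S s j k.+1) =
  (Pr (cylinder X S s j k) * (Q (s k) (s k.+1))%:E)%E.
Proof.
move=> [mX _ step]; elim: j s => [|j IHj] s jk.
  by rewrite /cylinder /= step.
have mC := measurable_cylinder S _ _ _ mX.
pose s' u l := if l == j then u else s l.
have cylI u r : (j <= r)%N -> cylinder X S s j.+1 r `&` [set w | X j w = u] =
    if u \in S then cylinder X S (s' u) j r else set0.
  move=> jr; apply/seteqP; split => [w [Cw /= Xu]|w].
    have := Cw j jr; rewrite ltnSn Xu => ->.
    move=> l lr; have := Cw l lr; rewrite ltnS /s'.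
    by case: (ltngtP l j) => // ->.
  case: ifP => // uS Cw; split => /=; last first.
    by have := Cw j jr; rewrite ltnn /s' eqxx.
  move=> l lr; have := Cw l lr; rewrite ltnS /s'.
  by case: (ltngtP l j) => // -> ->.
have split_at r : (j <= r)%N -> Pr (cylinder X S s j.+1 r) =
    (\sum_(u in S) Pr (cylinder X S (s' u) j r))%E.
  move=> jr; rewrite (@probability_split _ _ _ _ _ (X j) S)//.
    by apply: eq_bigr => u uS; rewrite cylI// uS.
  by move=> w Cw; have := Cw j jr; rewrite ltnSn.
rewrite !split_at//; [|exact: ltnW|exact: leq_trans (ltnW jk) (leqnSn k)].
rewrite ge0_sume_distrl//; apply: eq_bigr => u uS.
by rewrite IHj ?(ltnW jk)// /s' !gtn_eqF// ltnW.
Qed.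

(** The taboo probability of being at [v] at time [k] without an earlier visit to
the complement of [S]. For [v] outside [S] it is the probability that the walk
leaves [S] at time [k] and at [v]. *)
Definition taboo_prob (R : realType) (N : nat) (d : measure_display)
    (Omega : measurableType d) (Pr : probability Omega R)
    (X : nat -> Omega -> 'I_N) (S : {set 'I_N}) (k : nat) (v : 'I_N) : R :=
  fine (Pr (cylinder X S (fun=> v) k k)).

Lemma taboo_prob_ge0 (R : realType) (N : nat) (d : measure_display)
    (Omega : measurableType d) (Pr : probability Omega R)
    (X : nat -> Omega -> 'I_N) (S : {set 'I_N}) (k : nat) (v : 'I_N) :
  0 <= taboo_prob Pr X S k v.
Proof. exact: fine_ge0. Qed.

Lemma taboo_prob0 (R : realType) (N : nat) (Q : 'M[R]_N) (i : 'I_N)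
    (d : measure_display) (Omega : measurableType d) (Pr : probability Omega R)
    (X : nat -> Omega -> 'I_N) (S : {set 'I_N}) (v : 'I_N) :
  markov_chain_from Q i Pr X -> taboo_prob Pr X S 0 v = (v == i)%:R.
Proof.
move=> [mX X0 _]; rewrite /taboo_prob.
have cyl0 : cylinder X S (fun=> v) 0 0 = [set w | X 0%N w = v].
  apply/seteqP; split => w /=; first by move/(_ 0%N (leqnn _)).
  by move=> Xv l; rewrite leqn0 => /eqP ->.
rewrite cyl0; case: eqVneq => [->|vi]; first by rewrite X0.
suff -> : Pr [set w | X 0%N w = v] = 0%E by [].
apply: (@subset_measure0 _ _ _ _ _ (~` [set w | X 0%N w = i])) => //.
- exact: measurableC.
- by move=> w /= Xv Xi; rewrite -Xv Xi eqxx in vi.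
- by rewrite /= probability_setC// X0 subee.
Qed.

Lemma taboo_probS (R : realType) (N : nat) (Q : 'M[R]_N) (i : 'I_N)
    (d : measure_display) (Omega : measurableType d) (Pr : probability Omega R)
    (X : nat -> Omega -> 'I_N) (S : {set 'I_N}) (k : nat) (v : 'I_N) :
  markov_chain_from Q i Pr X ->
  taboo_prob Pr X S k.+1 v =
  \sum_(u in S) taboo_prob Pr X S k u * Q u v.
Proof.
move=> mc; have [mX _ _] := mc.
have mC := measurable_cylinder S _ _ _ mX.
have fC s j r : Pr (cylinder X S s j r) \is a fin_num by exact: fin_num_measure.
rewrite /taboo_prob (@probability_split _ _ _ _ _ (X k) S)//; last first.
  by move=> w /(_ k (leqnSn k)); rewrite ltnSn.
rewrite -sum_fine; last first.
  by move=> u _; apply: fin_num_measure; exact: measurableI.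
apply: eq_bigr => u uS; pose s l := if l == k then u else v.
have -> : cylinder X S (fun=> v) k.+1 k.+1 `&` [set w | X k w = u] =
    cylinder X S s k k.+1.
  apply/seteqP; split => [w [Cw /= Xu] l lk|w Cw].
    have := Cw l lk; rewrite ltnS /s.
    by case: (ltngtP l k) => // ->.
  have Xk : X k w = u by have := Cw k (leqnSn k); rewrite ltnn /s eqxx.
  split => //= l lk; have := Cw l lk; rewrite ltnS /s.
  by case: (ltngtP l k) => // -> ->.
rewrite (cylinder_step _ _ mc)// fineM// /s eqxx gtn_eqF//.
congr (fine (Pr _) * _); apply/seteqP.
by split => w Cw l lk; have := Cw l lk; move: lk; case: (ltngtP l k).
Qed.

(** * Absorption probabilities and harmonic functions *)

(** As [j] is outside [S], the events of reaching [j] through [S] at time [l] are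
disjoint for distinct [l]. *)
Lemma absorption_probability_cvg (R : realType) (N : nat)
    (d : measure_display) (Omega : measurableType d) (Pr : probability Omega R)
    (X : nat -> Omega -> 'I_N) (S : {set 'I_N}) (j : 'I_N) :
  (forall k v, measurable [set w | X k w = v]) -> j \notin S ->
  \sum_(0 <= l < k) taboo_prob Pr X S l j @[k --> \oo] -->
    absorption_probability Pr X S j.
Proof.
move=> mX jS; pose F l := cylinder X S (fun=> j) l l.
have mF l : measurable (F l) by exact: measurable_cylinder.
have FE l w : F l w <-> X l w = j /\ forall r, (r < l)%N -> X r w \in S.
  split=> [Fw|[Xl Xr] r]; last first.
    by rewrite leq_eqVlt => /orP[/eqP->|rl]; rewrite ?ltnn ?rl//; exact: Xr.
  split=> [|r rl]; first by have := Fw l (leqnn l); rewrite ltnn.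
  by have := Fw r (ltnW rl); rewrite rl.
have absE : absorption_event X S j = \bigcup_l F l.
  by apply/seteqP; split => w [l]; [move/FE => ?|move=> _ /FE ?]; exists l.
have tF : trivIset setT F.
  have lt_disj l r w : (l < r)%N -> F l w -> F r w -> False.
    move=> lr /FE[Xl _] /FE[_ /(_ l lr)].
    by rewrite Xl (negbTE jS).
  move=> l r _ _ [w [Fl Fr]]; case: (ltngtP l r) => // lr; exfalso.
    exact: lt_disj lr Fl Fr.
  exact: lt_disj lr Fr Fl.
have := measure_sigma_additive (mu := Pr) mF tF.
rewrite /absorption_probability absE => cvgF.
have /fine_cvg : (\sum_(0 <= l < k) Pr (F l))%E @[k --> \oo] -->
    (fine (Pr (\bigcup_l F l)))%:E.
  rewrite fineK; first exact: cvgF.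
  by apply: fin_num_measure; exact: bigcup_measurable.
apply: cvg_trans; apply: near_eq_cvg; near=> k => /=.
by rewrite -sum_fine// => l _; exact: fin_num_measure.
Unshelve. all: by end_near.
Qed.

Section AbsorbedWalk.
Variables (R : realType) (N : nat) (P : 'M[R]_N) (S : {set 'I_N}).
Let SM := in_neighbours (system_graph P) S.
Hypothesis hP : row_stochastic P.
Variables (i : 'I_N) (d : measure_display) (Omega : measurableType d).
Variables (Pr : probability Omega R) (X : nat -> Omega -> 'I_N).
Hypothesis iS : i \in S.
Hypothesis mc : markov_chain_from (absorbing_at SM P) i Pr X.

Let g := taboo_prob Pr X S.

(* Rows of nodes of [S] are not altered by making [SM] absorbing. *)
Let gS k v : g k.+1 v = \sum_(u in S) g k u * P u v.
Proof.
rewrite /g (taboo_probS _ _ _ mc); apply: eq_bigr => u uS; congr (_ * _).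
by rewrite mxE inE uS.
Qed.

Lemma taboo_expectationS (phi : 'I_N -> R) k :
  \sum_w g k.+1 w * phi w = \sum_(u in S) g k u * \sum_w P u w * phi w.
Proof.
under eq_bigr do rewrite gS mulr_suml.
rewrite exchange_big /=; apply: eq_bigr => u _; rewrite mulr_sumr.
by apply: eq_bigr => w _; rewrite mulrA.
Qed.

(** By the Markov property at time [k], both sides are the probability of being in
[S] at all times up to [k + l]. *)
Lemma taboo_survival k l :
  \sum_(v in S) g k v * survival P S l v = survival P S (k + l) i.
Proof.
elim: k l => [|k IHk] l.
  rewrite (bigD1 i)//= /g (taboo_prob0 _ _ mc) eqxx mul1r big1 ?addr0// => v.
  by case/andP => _ vi; rewrite (taboo_prob0 _ _ mc) (negbTE vi) mul0r.
rewrite addSnnS -IHk.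
have -> : \sum_(v in S) g k.+1 v * survival P S l v =
    \sum_v g k.+1 v * survival P S l v.
  rewrite [LHS]big_mkcond; apply: eq_bigr => v _; case: ifPn => // vS.
  by case: (l) => [|l'] /=; rewrite (negbTE vS) mulr0.
by rewrite taboo_expectationS; apply: eq_bigr => u uS; rewrite /= uS.
Qed.

Lemma taboo_prob_cvg0 v : open_component (system_graph P) S -> v \in S ->
  g k v @[k --> \oo] --> (0 : R).
Proof.
move=> hS vS.
apply: squeeze_cvgr (cvg_cst 0) (survival_cvg0 i hP hS).
near=> k; rewrite taboo_prob_ge0/= -[k in survival _ _ k]addn0 -taboo_survival.
rewrite (bigD1 v)//= vS mulr1 lerDl sumr_ge0// => u /andP[-> _].
by rewrite mulr1 taboo_prob_ge0.
Unshelve. all: by end_near.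
Qed.

(** Optional stopping for the exit time from [S] truncated at [k]: replacing each
[y v] by the mean of [y] after one more step moves the mass that has just left
[S], all of it to [SM], into the first sum. *)
Lemma harmonic_stopped (y : 'I_N -> R) k :
  {in S, forall v, y v = \sum_w P v w * y w} ->
  y i = \sum_(j in SM) (\sum_(0 <= l < k.+1) g l j) * y j +
        \sum_(v in S) g k v * y v.
Proof.
move=> yharm; elim: k => [|k ->].
  rewrite big1 ?add0r => [|j jSM]; last first.
    rewrite big_nat1 /g (taboo_prob0 _ _ mc); case: eqVneq => [ji|]; last first.
      by rewrite mul0r.
    by move: jSM; rewrite ji inE iS.
  rewrite (bigD1 i)//= /g (taboo_prob0 _ _ mc) eqxx mul1r big1 ?addr0// => v.
  by case/andP => _ vi; rewrite (taboo_prob0 _ _ mc) (negbTE vi) mul0r.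
have -> : \sum_(v in S) g k v * y v = \sum_w g k.+1 w * y w.
  by rewrite taboo_expectationS; apply: eq_bigr => v vS; rewrite yharm.
rewrite [X in _ + X](bigID [in S])/= addrCA addrC; congr (_ + _).
have -> : \sum_(w | w \notin S) g k.+1 w * y w =
    \sum_(j in SM) g k.+1 j * y j.
  rewrite [LHS]big_mkcond [RHS]big_mkcond; apply: eq_bigr => w _ /=.
  rewrite inE; case: (boolP (w \in S)) => //= wS; case: ifPn => // noedge.
  rewrite gS big1 ?mul0r// => u uS; have [P0 _] := hP.
  have := P0 u w; rewrite le_eqVlt => /orP[/eqP<-|Puw]; first by rewrite mulr0.
  by case/existsP: noedge; exists u; rewrite uS.
by rewrite -big_split/=; apply: eq_bigr => j _; rewrite -mulrDl -big_nat_recr.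
Qed.

Lemma harmonic_absorption (y : 'I_N -> R) :
  open_component (system_graph P) S ->
  {in S, forall v, y v = \sum_w P v w * y w} ->
  \sum_(j in SM) absorption_probability Pr X S j * y j = y i.
Proof.
move=> hS yharm; apply/esym.
apply: (@cvg_unique _ (@Rhausdorff R) (y i @[_ --> \oo])); first exact: cvg_cst.
rewrite -[\sum_(j in SM) _]addr0 -[X in _ + X](_ : \sum_(v in S) 0 * y v = 0).
  2: by apply: big1 => v _; rewrite mul0r.
rewrite (_ : (fun=> y i) = fun k =>
  \sum_(j in SM) (\sum_(0 <= l < k.+1) g l j) * y j +
  \sum_(v in S) g k v * y v); last first.
  by apply/funext => k; exact: harmonic_stopped.
apply: cvgD.
  apply: cvg_sumr => j jSM; apply: cvgMr_tmp.
  have [mX _ _] := mc.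
  have jS : j \notin S by move: jSM; rewrite inE => /andP[].
  by have := absorption_probability_cvg (Pr := Pr) mX jS; rewrite -cvg_shiftS.
by apply: cvg_sumr => v vS; apply: cvgMr_tmp; exact: taboo_prob_cvg0.
Qed.

End AbsorbedWalk.

(** * The limits on closed and open components *)

(** [piA *t piC] is a left fixed vector of [P_S], hence the weighted average that
it defines of the values on [S] is conserved by the process; on the limit, which
is constant on [S], this average is that constant. *)
Lemma closed_component_limit (R : realType) (N : nat) (P : 'M[R]_N)
    (S : {set 'I_N}) (a c : nat) (e : 'I_(a * c) -> 'I_N)
    (AS : 'M[R]_a) (CS : 'M[R]_c) (piA : 'cV[R]_a) (piC : 'cV[R]_c)
    (x0 : 'cV[R]_N) :
  row_stochastic P -> closed_component (system_graph P) S ->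
  factors_of_submatrix P S e AS CS ->
  stationary_distribution AS piA -> stationary_distribution CS piC ->
  cvgn (process P x0) -> {in S, forall i,
  equilibrium P x0 i 0 = ((piA *t piC)^T *m rowsub e x0 : 'M[R]_1) 0 0}.
Proof.
move=> hP hS [einj SE PS] hA hC cvx i iS.
have [piF pi1] := stationary_tens hA hC; set pi := (piA *t piC)^T in piF pi1 *.
have eS t : e t \in S by rewrite SE imset_f.
have step (x : 'cV[R]_N) : rowsub e (P *m x) = (AS *t CS) *m rowsub e x.
  apply/colP => t; rewrite -PS !mxE (bigID [in S])/= [X in _ + X]big1 ?addr0.
    rewrite SE big_imset/=; last by move=> u v _ _; exact: einj.
    by apply: eq_bigr => u _; rewrite !mxE.
  move=> w wS; have [P0 _] := hP; have [_ /(_ w (e t) wS (eS t))] := hS.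
  rewrite /system_graph -leNgt => Pw.
  by rewrite (@le_anti _ _ (P (e t) w) 0) ?mul0r// Pw P0.
have inv k : pi *m rowsub e (process P x0 k) = pi *m rowsub e x0.
  by elim: k => // k IHk; rewrite /process /= step mulmxA piF.
have inv_cvg : (pi *m rowsub e (process P x0 k)) 0 0 @[k --> \oo] -->
    (pi *m rowsub e x0) 0 0.
  by under eq_fun do rewrite inv; exact: cvg_cst.
apply: (@cvg_unique _ (@Rhausdorff R) _ _ _ _ _ inv_cvg).
have -> : equilibrium P x0 i 0 = \sum_t pi 0 t * equilibrium P x0 (e t) 0.
  rewrite -[LHS]mul1r -pi1 mulr_suml; apply: eq_bigr => t _; congr (_ * _).
  exact: (equilibrium_constant hP hS cvx).
rewrite /=; under eq_fun do rewrite mxE.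
apply: cvg_sumr => t _; apply: cvgMl_tmp.
under eq_fun do rewrite mxE.
exact: process_cvg_coord.
Qed.

Theorem theorem7 (R : realType) (n m : nat) (A : 'M[R]_n) (C : 'M[R]_m)
    (lam : 'rV[R]_n) (hA : row_stochastic A) (hC : row_stochastic C)
    (hlam : forall i, 0 <= lam 0 i <= 1)
    (hconv : converges_to_equilibrium (belief_matrix A C lam))
    (S : {set 'I_(n * m + n * m)}) :
  let P := belief_matrix A C lam in
  (closed_component (system_graph P) S ->
   forall (a c : nat) (e : 'I_(a * c) -> 'I_(n * m + n * m))
     (AS : 'M[R]_a) (CS : 'M[R]_c) (piA : 'cV[R]_a) (piC : 'cV[R]_c)
     (x0 : 'cV[R]_(n * m + n * m)) (xA : 'cV[R]_a) (xC : 'cV[R]_c),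
     row_stochastic AS -> row_stochastic CS ->
     factors_of_submatrix P S e AS CS ->
     stationary_distribution AS piA -> stationary_distribution CS piC ->
     in_unit_cube x0 -> rowsub e x0 = xA *t xC ->
     forall i, i \in S ->
       process P x0 k i 0 @[k --> \oo] -->
         ((piA *t piC)^T *m (xA *t xC) : 'M[R]_1) 0 0) /\
  (open_component (system_graph P) S ->
   forall x0 : 'cV[R]_(n * m + n * m), in_unit_cube x0 ->
   let SM := in_neighbours (system_graph P) S in
   forall (i : 'I_(n * m + n * m)) (d : measure_display)
     (Omega : measurableType d) (Pr : probability Omega R)
     (X : nat -> Omega -> 'I_(n * m + n * m)),
     i \in S -> markov_chain_from (absorbing_at SM P) i Pr X ->
     process P x0 k i 0 @[k --> \oo] -->
       \sum_(j in SM) absorption_probability Pr X S j * equilibrium P x0 j 0).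
Proof.
move=> P; have hP : row_stochastic P by exact: belief_matrix_stochastic.
split=> [hS a c e AS CS piA piC x0 xA xC _ _ hf hpA hpC hx0 x0E i iS|
  hS x0 hx0 SM i d Omega Pr X iS mc].
  rewrite -x0E -(closed_component_limit hP hS hf hpA hpC (hconv x0 hx0) iS).
  exact: process_cvg_coord (hconv x0 hx0).
rewrite (harmonic_absorption hP iS mc (y := fun w => equilibrium P x0 w 0) hS).
  exact: process_cvg_coord (hconv x0 hx0).
by move=> v _; exact: equilibrium_fixed (hconv x0 hx0).
Qed.
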